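(* The following three statements hold. (1) For every integer $m\geq 2$ with $m\neq 4$, there are infinitely many positive integers $n$ for which there exists a weighting $f:E(K_n)\to\{-1,1\}$ with $\sum_{e\in E(K_n)}f(e)=0$ such that no copy $H$ of $K_m$ in $K_n$ satisfies $\sum_{e\in E(H)}f(e)=0$. (2) Let $n\geq 5$ be an integer, and define $g(n)=2(n+1)$ if $n\equiv 0 \pmod 4$ and $g(n)=2n$ if $n\not\equiv 0\pmod 4$. Then for every weighting $f:E(K_n)\to\{-1,1\}$ with $\left|\sum_{e\in E(K_n)}f(e)\right|\leq \binom{n}{2}-g(n)$, there is a copy $H$ of $K_4$ in $K_n$ with $\sum_{e\in E(H)}f(e)=0$. (3) There are infinitely many positive integers $n$ for which there exists a weighting $f:E(K_n)\to\{-2,-1,0,1,2\}$ with $\sum_{e\in E(K_n)}f(e)=0$ such that no copy $H$ of $K_4$ in $K_n$ satisfies $\sum_{e\in E(H)}f(e)=0$.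
   Context: $K_n$ denotes the complete graph on $n$ vertices and $E(K_n)$ its edge set. A copy of $K_m$ in $K_n$ is the complete subgraph induced on some set of $m$ vertices of $K_n$. *)

(* Defs.v *)
From mathcomp Require Import all_boot all_order all_algebra.

Set Implicit Arguments.
Unset Strict Implicit.
Unset Printing Implicit Defensive.

Import Order.TTheory GRing.Theory Num.Theory.

Local Open Scope ring_scope.

(* Edges are unordered pairs, that is, 2-element sets of vertices. The complete
   subgraph induced on S is identified with its vertex set S. *)
Definition complete_edges (T : finType) (S : {set T}) : {set {set T}} :=
  [set e : {set T} | (e \subset S) && (#|e| == 2%N)].

(* A weighting of E(K_n) is given as a total function on sets of vertices; its
   values outside E(K_n) are unconstrained and never used. *)
Definition weighting (n : nat) (W : seq int) (f : {set 'I_n} -> int) : Prop :=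
  forall e, e \in complete_edges [set: 'I_n] -> f e \in W.

Definition weight (n : nat) (f : {set 'I_n} -> int) (S : {set 'I_n}) : int :=
  \sum_(e in complete_edges S) f e.

Definition zero_sum_copy (n m : nat) (f : {set 'I_n} -> int) : Prop :=
  exists S : {set 'I_n}, #|S| = m /\ weight f S = 0.

Definition infinitely_many (P : nat -> Prop) : Prop :=
  forall N : nat, exists n : nat, (N < n)%N /\ P n.

Definition g (n : nat) : nat :=
  (if n %% 4 == 0 then 2 * n.+1 else 2 * n)%N.

(* Main.v *)
(* Parts (1) and (3).  In a weighting depending only on a vertex set [A], the
   weight of a copy depends only on how many of its vertices lie in [A].  Giving
   -1 to the edges across a cut and 1 to the others, a set of [m] vertices with [j]
   and [k] on the two sides has weight [((j-k)^2 - m)/2], which is never zero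
   unless [m] is a square.  For [m = q^2] put 1 inside [A] and -1 elsewhere: zero
   weight means [2j(j-1) = m(m-1)], i.e. [q^4 + (q^2-1)^2 = (2j-1)^2].
   Parametrizing this Pythagorean triple leads to [v^4 = 2s^2+1] for odd [q] and
   to [8a^4+1 = z^2], hence [x^4 - 2y^4 = 1] or [-1], for even [q]; with Fermat's
   theorem on [a^4 - b^4 = c^2] only [q <= 2] remains.  The global weight is made
   zero by Pell recurrences.

   Part (2).  In the graph of the edges of weight 1, no four vertices span exactly
   three edges.  A triangle and an independent triple then cannot coexist, so up
   to sign the graph is triangle-free.  Being claw-free as well, it has maximum
   degree 2, hence at most [n] edges, and if it has [n] edges it is a disjoint
   union of 4-cycles, so that 4 divides [n]. *)

Require Import Defs.
From mathcomp Require Import all_boot all_order all_algebra.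
From mathcomp Require Import zify.

Import Order.TTheory GRing.Theory Num.Theory.

Local Open Scope ring_scope.

(** * Diophantine equations with squares and fourth powers *)

Section FourthPowers.
Local Open Scope nat_scope.

(** If [u * v = w ^ 2] and [d = gcdn u w], write [u = u' * d] and [w = w' * d]. Then
    [u' * v = d * w' ^ 2], and coprimality makes [u'] and [d] divide each other. *)
Lemma coprime_mul_square a b c : coprime a b -> a * b = c ^ 2 ->
  exists x y, a = x ^ 2 /\ b = y ^ 2.
Proof.
suff P u v w : coprime u v -> u * v = w ^ 2 -> u = gcdn u w ^ 2.
  move=> cab abc; exists (gcdn a c), (gcdn b c); split; first exact: P abc.
  by apply: (P b a c); rewrite 1?coprime_sym // mulnC.
move=> cuv uvw.
have [u0|u_gt0] := posnP u; first by rewrite u0 gcd0n -uvw u0.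
have d_gt0 : 0 < gcdn u w by rewrite gcdn_gt0 u_gt0.
have [/dvdnP[u' eu] /dvdnP[w' ew]] := (dvdn_gcdl u w, dvdn_gcdr u w).
have cuw' : coprime u' w'.
  rewrite /coprime -(eqn_pmul2r d_gt0) muln_gcdl -eu -ew mul1n.
  by rewrite eqxx.
have e : u' * v = gcdn u w * w' ^ 2.
  apply/eqP; rewrite -(eqn_pmul2r d_gt0); apply/eqP.
  rewrite mulnAC -eu uvw {1}ew; lia.
suff u'd : u' = gcdn u w by rewrite {1}eu u'd mulnn.
apply/eqP; rewrite eqn_dvd; apply/andP; split.
  by rewrite -(@Gauss_dvdl _ _ (w' ^ 2)) ?coprimeXr // -e dvdn_mulr.
rewrite -(@Gauss_dvdl _ _ v); first by rewrite e dvdn_mulr.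
by apply: coprime_dvdl cuv; apply: dvdn_gcdl.
Qed.

(** The numbers [(c + a) / 2] and [(c - a) / 2] are coprime with product [(b / 2) ^ 2], so both are
    squares. The form [a + s ^ 2 = r ^ 2] avoids truncated subtraction. *)
Lemma pythagorean_triple a b c : coprime a b -> odd a -> a ^ 2 + b ^ 2 = c ^ 2 ->
  exists r s, [/\ coprime r s, odd (r + s), a + s ^ 2 = r ^ 2,
                  b = 2 * r * s & c = r ^ 2 + s ^ 2].
Proof.
move=> cab oa e.
(* Two odd squares add up to 2 modulo 4, which is not a square. *)
have ob : ~~ odd b.
  apply/negP => ob.
  have : (a = 2 * a./2 + 1) by lia.
  have : (b = 2 * b./2 + 1) by lia.
  have : (c = 2 * c./2 + odd c) by lia.
  move: (a./2) (b./2) (c./2) => x y z ec eb ea.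
  move: e; rewrite ea eb ec; case: (odd c) => /=; lia.
have oc : odd c by have := congr1 odd e; rewrite oddD !oddX oa (negPf ob).
have le_ac : a <= c by rewrite -leq_sqr -e leq_addr.
set v := (c - a)./2; have ev : c = a + 2 * v by rewrite /v; lia.
set d := b./2; have ed : b = 2 * d by rewrite /d; lia.
have uv : (a + v) * v = d ^ 2 by move: e; rewrite ev ed; lia.
have cav : coprime (a + v) v.
  have -> : coprime (a + v) v = coprime a v.
    by rewrite coprime_sym /coprime gcdnDr gcdnC.
  apply: (@coprime_dvdr _ (d ^ 2)); first by rewrite -uv dvdn_mull.
  by apply: coprimeXr; apply: coprime_dvdr cab; rewrite ed dvdn_mull.
have [r [s [er es]]] := coprime_mul_square _ _ _ cav uv.
have eds : d = r * s.
  by apply/eqP; rewrite -eqn_sqr -uv er es expnMn.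
exists r, s; split.
- by move: cav; rewrite er es coprime_pexpl // coprime_pexpr.
- by move: oc; rewrite ev mul2n -addnn addnA oddD er es !oddX oddD.
- by rewrite -er es addnC -es.
- by rewrite ed eds mulnA.
- lia.
Qed.

(** Infinite descent on [a], starting from the triple [b ^ 2], [c], [a ^ 2]. *)
Lemma fermat_right_triangle a b c : coprime a b -> 0 < b -> 0 < c ->
  a ^ 4 = b ^ 4 + c ^ 2 -> False.
Proof.
have [k] := ubnP a; elim: k => // k IH in a b c *; rewrite ltnS => le_ak.
move=> cab b_gt0 c_gt0 e.
have cbc : coprime (b ^ 2) c.
  have : coprime (b ^ 4) (c ^ 2).
    rewrite /coprime -gcdnDl -e; apply: coprimeXl; apply: coprimeXr.
    by rewrite coprime_sym.
  by rewrite coprime_pexpl // coprime_pexpr // => /coprimeXl ->.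
have e2 : (b ^ 2) ^ 2 + c ^ 2 = (a ^ 2) ^ 2 by rewrite -!expnM e.
(* For odd [b], multiplying [a ^ 2 = r ^ 2 + s ^ 2] by [b ^ 2 = r ^ 2 - s ^ 2] gives the smaller
   solution [r ^ 4 = s ^ 4 + (a * b) ^ 2]. *)
have [ob|eb] := boolP (odd b).
  have [|r [s [crs _ eb2 ec ea2]]] := pythagorean_triple _ _ _ cbc _ e2.
    by rewrite oddX ob orbT.
  have s_gt0 : 0 < s by case: (s) ec => //; rewrite muln0; lia.
  have r_gt0 : 0 < r by case: (r) ec => //; rewrite muln0; lia.
  apply: (IH r s (a * b)) => //.
    by apply: leq_trans le_ak; rewrite -ltn_sqr ea2; nia.
    by rewrite muln_gt0 b_gt0 andbT; case: (a) e => //; nia.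
  rewrite expnMn ea2 -(addnK (s ^ 2) (b ^ 2)) eb2; nia.
have oa : odd a.
  apply: contraLR cab => ea; rewrite /coprime gtn_eqF //.
  suff: 2 %| gcdn a b by move/dvdn_leq; rewrite gcdn_gt0 b_gt0 orbT => ->.
  by rewrite dvdn_gcd !dvdn2 ea eb.
have oc : odd c.
  have := congr1 odd e; rewrite oddD !oddX oa (negPf eb) /=.
  by case: (odd c).
have [|||r [s [crs ors ec eb2 ea2]]] := pythagorean_triple c (b ^ 2) (a ^ 2).
- by rewrite coprime_sym.
- by rewrite oc.
- by rewrite addnC.
(* [2 * r'] is the even one of [r] and [s], and [s'] the odd one. Since [r' * s'] is the square of
   [b / 2], they are squares [u ^ 2] and [v ^ 2]. *)
have [r' [s' [cr' os' eb' ea']]] : exists r' s', [/\ coprime (2 * r') s', odd s',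
    b ^ 2 = 4 * r' * s' & a ^ 2 = (2 * r') ^ 2 + s' ^ 2].
  have [os|es] := boolP (odd s).
    have er : r = 2 * r./2 by move: ors; rewrite oddD os; lia.
    by exists r./2, s; split; rewrite -?er //; rewrite eb2 {1}er; lia.
  have es' : s = 2 * s./2 by lia.
  exists s./2, r; split; rewrite -?es' //; first by rewrite coprime_sym.
  - by move: ors; rewrite oddD (negPf es) addbF.
  - by rewrite eb2 {1}es'; lia.
  - by rewrite addnC.
have [||u [v [er es]]] := coprime_mul_square r' s' b./2.
- by apply: coprime_dvdl cr'; rewrite dvdn_mull.
- have eb3 : b = 2 * b./2 by move: eb; clear; lia.
  by move: eb'; rewrite {1}eb3; clear; lia.
have ov : odd v by move: os'; rewrite es oddX.
rewrite {}es {}er in cr' ea' eb'.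
have cvu : coprime (v ^ 2) (2 * u ^ 2).
  by rewrite coprime_sym -(@coprime_pexpr 2) //; apply: coprimeXr.
(* A second triple, [v ^ 2], [2 * u ^ 2], [a], has [p * q = u ^ 2]. Hence [p = x ^ 2] and
   [q = y ^ 2], and [x ^ 4 = y ^ 4 + v ^ 2] with [x < a]. *)
have [||| p [q [cpq _ epq euv eapq]]] := pythagorean_triple (v ^ 2) (2 * u ^ 2) a.
- by [].
- by rewrite oddX ov orbT.
- by rewrite addnC ea'.
have [|x [y [ep eq]]] := coprime_mul_square p q u cpq.
  by move: euv; clear; lia.
move: cpq epq euv eapq; rewrite ep eq coprime_pexpl // coprime_pexpr //.
move=> cxy epq euv ea.
have u_gt0 : 0 < u.
  case: (u) eb' => //; rewrite exp0n // muln0 => /eqP.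
  by rewrite expn_eq0 eqn0Ngt b_gt0.
have y_gt0 : 0 < y.
  case: (y) euv => //; rewrite [0 ^ 2]exp0n // muln0 => /eqP.
  by rewrite muln_eq0 expn_eq0 (gtn_eqF u_gt0).
have le_sqr t : t <= t ^ 2 by case: t => // t; rewrite -{1}(expn1 t.+1) leq_pexp2l.
apply: (IH x y v) => //.
- apply: leq_trans le_ak; rewrite ea.
  rewrite -[X in X < _]addn0 -addnS leq_add ?expn_gt0 ?y_gt0 //.
  exact: leq_trans (le_sqr x) (le_sqr _).
- by case: (v) ov.
- by rewrite -!expnM in epq; rewrite -epq addnC.
Qed.

(** With [v ^ 2 = 4 * t + 1] the equation reads [4 * t * (2 * t + 1) = s ^ 2], so [4 * t] is a
    square. Then [v ^ 2] and [v ^ 2 - 1] are both squares, whence [t = 0]. *)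
Lemma pow4_eq_double_sq_add1 v s : v ^ 4 = 2 * s ^ 2 + 1 -> s = 0.
Proof.
move=> e.
have ov : odd v by have := congr1 odd e; rewrite oddX oddD oddM.
have [t et] : exists t, v ^ 2 = 4 * t + 1.
  have ev : v = 2 * v./2 + 1 by lia.
  by exists (v./2 * v./2.+1); rewrite {1}ev; lia.
have eq : (4 * t) * (2 * t + 1) = s ^ 2.
  by move: e; rewrite (expnM v 2 2) et; lia.
have [|x [y [ex _]]] := coprime_mul_square _ _ _ _ eq.
  rewrite coprimeMl (@coprime_pexpl 2 2) // coprime2n addn1 /= oddM /=.
  by apply: coprime_dvdl (coprimenS _); apply: dvdn_mull.
have lt_xv : x.+1 ^ 2 <= v ^ 2 by rewrite leq_sqr -ltn_sqr et -ex addn1.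
have x0 : x = 0 by move: lt_xv; rewrite et ex; lia.
by move: ex eq; rewrite x0 => ->; case: (s).
Qed.

Lemma double_oblong_square q j : 2 < q ->
  2 * (j * j.-1) = q ^ 2 * (q ^ 2).-1 -> False.
Proof.
move=> q_gt2 e.
have [p ep] : exists p, q ^ 2 = p.+1.
  by exists (q ^ 2).-1; rewrite prednK // expn_gt0; lia.
have p_gt7 : 7 < p by rewrite -ltnS -ep -[9]/(3 ^ 2) leq_sqr.
have e1 : (q ^ 2) ^ 2 + p ^ 2 = (2 * j).-1 ^ 2.
  move: e; rewrite ep /=; case: j => [|j]; first by rewrite !mul0n; lia.
  by rewrite mulnS /=; lia.
have cop : coprime (q ^ 2) p by rewrite ep coprimeSn.
have [oq|eq] := boolP (odd q).
  have [|r [s [crs ors er ep2 _]]] := pythagorean_triple _ _ _ cop _ e1.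
    by rewrite oddX oq orbT.
  have lt_sr : s < r by rewrite -ltn_sqr -er; lia.
  (* Here [q ^ 2 = (r - s) * (r + s)] with coprime factors, so [d = v ^ 2]. Comparing with
     [q ^ 2 = 2 * r * s + 1] leaves [d ^ 2 = 2 * s ^ 2 + 1]. *)
  have [d ed] : exists d, r = d + s by exists (r - s); lia.
  have cds : coprime d (d + 2 * s).
    have od : odd d by move: ors; rewrite ed -addnA addnn oddD odd_double addbF.
    rewrite /coprime gcdnDl -/(coprime _ _) coprimeMr coprimen2 od /=.
    by move: crs; rewrite ed coprime_sym /coprime gcdnDr gcdnC.
  have dq : d * (d + 2 * s) = q ^ 2 by move: er; rewrite ed; lia.
  have [v [_ [dv _]]] := coprime_mul_square _ _ _ cds dq.
  have s0 : s = 0.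
    apply: (@pow4_eq_double_sq_add1 v); rewrite (expnM v 2 2) -dv.
    by move: dq; rewrite ep ep2 ed; clear; lia.
  by move: p_gt7; rewrite ep2 s0 muln0.
have op : odd p by have := congr1 odd ep; rewrite oddX (negPf eq) /= => /esym /negbFE.
have [|||r [s [crs ors er eq2 _]]] := pythagorean_triple p (q ^ 2) (2 * j).-1.
- by rewrite coprime_sym.
- by [].
- by rewrite addnC.
(* If [s] were even, [p = r ^ 2 - s ^ 2] would be 1 modulo 4, whereas [q ^ 2 - 1] is 3 modulo 4. *)
have es : odd s.
  apply/negPn/negP => es; have or : odd r by move: ors; rewrite oddD (negPf es) addbF.
  have [s' es'] : exists k, s = 2 * k by exists s./2; lia.
  have [r' er'] : exists k, r = 2 * k + 1 by exists r./2; lia.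
  have [q' eq'] : exists k, q = 2 * k by exists q./2; lia.
  by move: er ep; rewrite es' er' eq'; clear; lia.
have [r' er'] : exists k, r = 2 * k by exists r./2; move: ors; rewrite oddD es; lia.
have [q' eq'] : exists k, q = 2 * k by exists q./2; lia.
have rs : r' * s = q' ^ 2 by move: eq2; rewrite er' eq'; clear; lia.
have [|a [b [ea eb]]] := coprime_mul_square _ _ _ _ rs.
  by apply: coprime_dvdl crs; rewrite er' dvdn_mull.
(* This is [4 * a ^ 4 - b ^ 4 + 1 = 4 * a ^ 2 * b ^ 2] with the square completed. *)
have eab : 8 * a ^ 4 + 1 = (b ^ 2 + 2 * a ^ 2) ^ 2.
  move: er ep; rewrite eq2 er' ea eb (expnM a 2 2).
  by move: (a ^ 2) (b ^ 2) => A B; clear; lia.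
have [w ew] : exists w, b ^ 2 + 2 * a ^ 2 = 2 * w + 1.
  have := congr1 odd eab; rewrite oddD oddM [in RHS]oddX /= => h.
  by exists (b ^ 2 + 2 * a ^ 2)./2; move: (_ + _) h => z; clear; lia.
have ww : w * w.+1 = 2 * a ^ 4 by move: eab; rewrite ew; move: (a ^ 4) => A; clear; lia.
have q'ab : q' = a * b by apply/eqP; rewrite -eqn_sqr -rs ea eb expnMn.
have a_gt0 : 0 < a by rewrite lt0n; apply: contraTneq q_gt2; rewrite eq' q'ab => ->.
(* In [w * w.+1 = 2 * a ^ 4] the odd factor and half of the even one are coprime, so both are fourth
   powers [x ^ 4] and [y ^ 4]. The parity of [w] decides the sign in [x ^ 4 - 2 * y ^ 4 = -1] or
   [1]. *)
have a_le1 : a <= 1.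
  have [ow|ow] := boolP (odd w).
    have [h eh] : exists h, w.+1 = 2 * h by exists w.+1./2; move: ow; clear; lia.
    have wh : w * h = (a ^ 2) ^ 2.
      by move: ww; rewrite eh -expnM; move: (a ^ 4) => A; clear; lia.
    have cwh : coprime w h by apply: coprime_dvdr (coprimenS w); rewrite eh dvdn_mull.
    have [w2 [h2 [ew2 eh2]]] := coprime_mul_square _ _ _ cwh wh.
    have a_wh : w2 * h2 = a ^ 2 by apply/eqP; rewrite -eqn_sqr -wh ew2 eh2 expnMn.
    have cwh2 : coprime w2 h2.
      by move: cwh; rewrite ew2 eh2 coprime_pexpl // coprime_pexpr.
    have [x [y [ex ey]]] := coprime_mul_square _ _ _ cwh2 a_wh.
    have exy : x ^ 4 + 1 = 2 * y ^ 4.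
      by rewrite (expnM x 2 2) (expnM y 2 2) -ex -ey -ew2 -eh2 -eh addn1.
    have x_gt0 : 0 < x by move: ow; rewrite ew2 ex; case: (x).
    have cyx : coprime (y ^ 2) x.
      by move: cwh2; rewrite coprime_sym ex ey [coprime _ (x ^ 2)]coprime_pexpr.
    have [|y4_gt0] := posnP (y ^ 4).-1.
      move=> y4; have y1 : y ^ 4 = 1 by move: exy y4; clear; lia.
      have x1 : x ^ 4 = 1 by move: exy; rewrite y1; clear; lia.
      have y1' : y = 1 by apply/eqP; rewrite -(@eqn_exp2r _ _ 4) ?y1.
      have x1' : x = 1 by apply/eqP; rewrite -(@eqn_exp2r _ _ 4) ?x1.
      by rewrite -leq_sqr -a_wh ex ey x1' y1'.
    (* From [x ^ 4 = 2 * y ^ 4 - 1] follows [y ^ 8 = x ^ 4 + (y ^ 4 - 1) ^ 2]. *)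
    case: (@fermat_right_triangle (y ^ 2) x (y ^ 4).-1) => //.
    rewrite -expnM (expnM y 4 2).
    by move: exy y4_gt0; move: (x ^ 4) (y ^ 4) => X [|Y]; clear; lia.
  have [h eh] : exists h, w = 2 * h by exists w./2; move: ow; clear; lia.
  have wh : h * w.+1 = (a ^ 2) ^ 2.
    by move: ww; rewrite {1}eh -expnM; move: (a ^ 4) => A; clear; lia.
  have cwh : coprime h w.+1.
    by apply: coprime_dvdl (coprimenS w); rewrite eh dvdn_mull.
  have [h2 [w2 [eh2 ew2]]] := coprime_mul_square _ _ _ cwh wh.
  have a_wh : h2 * w2 = a ^ 2 by apply/eqP; rewrite -eqn_sqr -wh ew2 eh2 expnMn.
  have cwh2 : coprime h2 w2.
    by move: cwh; rewrite ew2 eh2 coprime_pexpl // coprime_pexpr.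
  have [y [x [ey ex]]] := coprime_mul_square _ _ _ cwh2 a_wh.
  have /pow4_eq_double_sq_add1 y0 : x ^ 4 = 2 * (y ^ 2) ^ 2 + 1.
    by rewrite (expnM x 2 2) -ex -ey -ew2 -eh2 -eh addn1.
  by move: a_wh a_gt0; rewrite ey y0 mul0n; case: (a).
have b_le1 : b <= 1.
  rewrite -leq_sqr; have : b ^ 2 + 2 * a ^ 2 <= 3.
    by rewrite -leq_sqr -eab; case: (a) a_le1 => [|[|]].
  by case: (a) a_gt0 a_le1 => [|[|]] // _ _; rewrite exp1n; clear; lia.
move: q_gt2; rewrite eq' q'ab.
by case: (a) (b) a_le1 b_le1 => [|[|]] // [|[|]].
Qed.
End FourthPowers.

(** * Weights of copies in clique and cut weightings *)

Lemma double_bin2 k : 2 * 'C(k, 2)%:Z = k%:Z * (k%:Z - 1).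
Proof. by elim: k => [|k IH]; rewrite ?bin0n // binS bin1; lia. Qed.

Lemma card_complete_edges (T : finType) (S : {set T}) :
  #|complete_edges S| = 'C(#|S|, 2).
Proof. exact: cards_draws. Qed.

Lemma sum_subset_complete_edges (T : finType) (A S : {set T}) :
  \sum_(e in complete_edges S) (e \subset A)%:R = 'C(#|S :&: A|, 2)%:Z.
Proof.
rewrite -card_complete_edges -sum1_card -[RHS]natz natr_sum.
rewrite (bigID (fun e : {set T} => e \subset A)) /= [X in _ + X]big1 ?addr0; last first.
  by move=> e /andP[_ /negPf->].
apply: eq_big => [e|e /andP[_ ->]] //.
by rewrite !inE subsetI andbAC.
Qed.

Lemma exists_set_card n k : (k <= n)%N -> exists A : {set 'I_n}, #|A| = k.
Proof.
move=> le_kn; exists [set widen_ord le_kn i | i : 'I_k].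
by rewrite card_imset ?card_ord // => i j /(congr1 val) /= /val_inj.
Qed.

Definition clique_weighting n (A : {set 'I_n}) (a b : int) (e : {set 'I_n}) : int :=
  if e \subset A then a else b.

Lemma weight_clique_weighting n (A : {set 'I_n}) (a b : int) S :
  weight (clique_weighting n A a b) S =
  b * 'C(#|S|, 2)%:Z + (a - b) * 'C(#|S :&: A|, 2)%:Z.
Proof.
rewrite -sum_subset_complete_edges -card_complete_edges mulr_sumr.
rewrite -natz -sum1_card natr_sum mulr_sumr -big_split /=; apply: eq_bigr => e _.
by rewrite /clique_weighting; case: (e \subset A); lia.
Qed.

Definition cut_weighting n (A e : {set 'I_n}) : int :=
  if (e \subset A) || (e \subset ~: A) then 1 else -1.

Lemma double_weight_cut_weighting n (A S : {set 'I_n}) :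
  2 * weight (cut_weighting n A) S =
  (#|S :&: A|%:Z - #|S :\: A|%:Z) ^+ 2 - #|S|%:Z.
Proof.
have -> : weight (cut_weighting n A) S =
    2 * ('C(#|S :&: A|, 2)%:Z + 'C(#|S :&: ~: A|, 2)%:Z) - 'C(#|S|, 2)%:Z.
  rewrite -!sum_subset_complete_edges -card_complete_edges.
  rewrite -[X in _ - X]natz -sum1_card natr_sum -!big_split mulr_sumr -sumrB /=.
  apply: eq_bigr => e; rewrite inE /cut_weighting => /andP[_ /cards2P[x [y [_ ->]]]].
  rewrite !subUset !sub1set !inE.
  by case: (x \in A); case: (y \in A).
rewrite -setDE; have /(congr1 Posz) := cardsID A S; rewrite PoszD => <-.
have := double_bin2 #|S :&: A|; have := double_bin2 #|S :\: A|.
have := double_bin2 (#|S :&: A| + #|S :\: A|); rewrite cardsID.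
by have := cardsID A S; nia.
Qed.

(** * Pell recurrences for balanced cliques *)

Lemma half_density_cliques N : exists n k : nat,
  [/\ (N < n)%N, (k <= n)%N & 2 * 'C(k, 2)%:Z = 'C(n, 2)%:Z].
Proof.
suff [n [k [Nn kn k_gt0 e]]] : exists n k : nat,
    [/\ (N < n)%N, (k <= n)%N, (0 < k)%N &
        2 * (k%:Z * (k%:Z - 1)) = n%:Z * (n%:Z - 1)].
  by exists n, k; split=> //; have := double_bin2 n; have := double_bin2 k; lia.
elim: N => [|N [n [k [Nn kn k_gt0 e]]]]; first by exists 1, 1.
(* With [X = 2n - 1] and [Y = 2k - 1] the equation is [X^2 - 2Y^2 = -1]; the step multiplies
   [X + Y sqrt 2] by [3 + 2 sqrt 2]. *)
by exists (3 * n + 4 * k - 3)%N, (2 * n + 3 * k - 2)%N; split; nia.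
Qed.

Lemma third_density_cliques N : exists n k : nat,
  [/\ (N < n)%N, (k <= n)%N & 3 * 'C(k, 2)%:Z = 'C(n, 2)%:Z].
Proof.
suff [n [k [Nn kn k_gt0 e]]] : exists n k : nat,
    [/\ (N < n)%N, (k <= n)%N, (0 < k)%N &
        3 * (k%:Z * (k%:Z - 1)) = n%:Z * (n%:Z - 1)].
  by exists n, k; split=> //; have := double_bin2 n; have := double_bin2 k; lia.
elim: N => [|N [n [k [Nn kn k_gt0 e]]]]; first by exists 1, 1.
(* In the same coordinates, [X^2 - 3Y^2 = -2], and the step multiplies [X + Y sqrt 3] by
   [2 + sqrt 3]. *)
by exists (2 * n + 3 * k - 2)%N, (n + 2 * k - 1)%N; split; nia.
Qed.

(** * Weightings of total zero without zero-sum copies *)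

Lemma no_zero_sum_copy_square m : (2 < m)%N ->
  infinitely_many (fun n : nat =>
    exists f : {set 'I_n} -> int,
      [/\ weighting [:: -1; 1] f,
          weight f [set: 'I_n] = 0
        & ~ zero_sum_copy (m ^ 2)%N f]).
Proof.
move=> m_gt2 N; have [n [k [Nn kn e]]] := half_density_cliques N.
have [A cA] := exists_set_card _ _ kn; exists n; split=> //.
exists (clique_weighting n A 1 (-1)); split.
- by move=> s _; rewrite /clique_weighting; case: ifP.
- by rewrite weight_clique_weighting setTI cardsT card_ord cA; lia.
case=> S [cS]; rewrite weight_clique_weighting cS.
set j := #|_| => w0; apply: (@double_oblong_square m j) => //.
have := double_bin2 j; have := double_bin2 (m ^ 2)%N; move: w0.
rewrite -!(subn1 _); move: (m ^ 2)%N 'C(j, 2) => M c.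
by case: j => [|j]; case: M => [|M]; lia.
Qed.

Lemma no_zero_sum_copy_nonsquare m : (forall q, m <> q ^ 2)%N ->
  infinitely_many (fun n : nat =>
    exists f : {set 'I_n} -> int,
      [/\ weighting [:: -1; 1] f,
          weight f [set: 'I_n] = 0
        & ~ zero_sum_copy m f]).
Proof.
move=> nsq N; pose q := N.+2.
(* The sides of the cut have sizes ['C(q, 2)] and ['C(q.+1, 2)]. Their sum is [q ^ 2] and their
   difference [q], so the total weight is zero. *)
have le_binq : ('C(q, 2) <= q ^ 2)%N by have := double_bin2 q; nia.
have [A cA] := exists_set_card _ _ le_binq; exists (q ^ 2)%N; split.
  by rewrite /q; nia.
exists (cut_weighting _ A); split.
- by move=> s _; rewrite /cut_weighting; case: ifP.
- apply: (@mulfI _ 2) => //; rewrite double_weight_cut_weighting mulr0.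
  have := cardsID A [set: 'I_(q ^ 2)]; rewrite setTI cardsT card_ord cA.
  have := double_bin2 q; nia.
case=> S [cS w0]; have := double_weight_cut_weighting _ A S.
rewrite w0 mulr0 cS => /esym /eqP; rewrite subr_eq0 => /eqP e.
apply: (nsq `|#|S :&: A|%:Z - #|S :\: A|%:Z|%N).
by apply/eqP; rewrite -eqz_nat -e -abszX; lia.
Qed.

(** With 2 inside [A] and -1 elsewhere, a copy with [j] vertices in [A] weighs [3 * 'C(j, 2) - 6],
    and no binomial ['C(j, 2)] equals 2. *)
Lemma no_zero_sum_copy4 :
  infinitely_many (fun n : nat =>
    exists f : {set 'I_n} -> int,
      [/\ weighting [:: -2; -1; 0; 1; 2] f,
          weight f [set: 'I_n] = 0
        & ~ zero_sum_copy 4 f]).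
Proof.
move=> N; have [n [k [Nn kn e]]] := third_density_cliques N.
have [A cA] := exists_set_card _ _ kn; exists n; split=> //.
exists (clique_weighting n A 2 (-1)); split.
- by move=> s _; rewrite /clique_weighting; case: ifP.
- by rewrite weight_clique_weighting setTI cardsT card_ord cA; lia.
case=> S [cS]; rewrite weight_clique_weighting cS.
have : (#|S :&: A| <= 4)%N by rewrite -cS subset_leq_card ?subsetIl.
by case: #|_| => [|[|[|[|[|]]]]].
Qed.

(** * Graphs in which no four vertices span exactly three edges *)

Section ThreeEdgeFreeGraphs.
Local Open Scope nat_scope.

Lemma eq_set2_card2 (T : finType) (A : {set T}) x y :
  #|A| = 2 -> x != y -> x \in A -> y \in A -> A = [set x; y].
Proof.
move=> cA nxy xA yA; apply/esym/eqP.
by rewrite eqEcard cA cards2 nxy andbT subUset !sub1set xA yA.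
Qed.

(** For weights 1 and -1, a copy of [K_4] has weight zero exactly when three of its six edges have
    weight 1. *)
Definition three_edge_free (T : finType) (e : rel T) : Prop :=
  forall x y z t, uniq [:: x; y; z; t] ->
    (e x y + e x z + e x t + e y z + e y t + e z t) != 3.

Section ThreeEdgeFree.
Variables (T : finType) (e : rel T).
Hypotheses (esym : symmetric e) (eirr : irreflexive e) (He : three_edge_free _ e).

Let neq_e x y : e x y -> x != y.
Proof. by apply: contraTneq => ->; rewrite eirr. Qed.

Let Heb x y z t : uniq [:: x; y; z; t] ==>
    ((e x y + e x z + e x t + e y z + e y t + e z t) != 3).
Proof. by apply/implyP => u; apply: He. Qed.

(** Each of [v], [w] is adjacent to [y] or [z], by the quadruples containing [x y z]. Neither [y]
    nor [z] is adjacent to both, by those containing [x v w]. So [y z v w] spans a path of three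
    edges. *)
Lemma triangle_cotriangle_sharing x y z v w :
  e x y -> e x z -> e y z -> v != w -> x != v -> x != w ->
  ~~ e x v -> ~~ e x w -> ~~ e v w -> False.
Proof.
move=> exy exz eyz nvw nxv nxw /negPf exv /negPf exw /negPf evw.
have [[nxy nxz] nyz] := (neq_e _ _ exy, neq_e _ _ exz, neq_e _ _ eyz).
have nyv : y != v by apply: contraFneq exv => <-.
have nyw : y != w by apply: contraFneq exw => <-.
have nzv : z != v by apply: contraFneq exv => <-.
have nzw : z != w by apply: contraFneq exw => <-.
have := Heb x y z v; have := Heb x y z w; have := Heb x y v w; have := Heb x z v w.
have := Heb y z v w; rewrite /= !inE !negb_or nvw nxv nxw nxy nxz nyz nyv nyw nzv nzw.
rewrite exy exz eyz exv exw evw.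
by move: (e y v) (e y w) (e z v) (e z w) => [] [] [] [].
Qed.

(** The triples are disjoint by the previous lemma. Each of [u v w] then has a neighbour in the
    triangle, none of [x y z] sees all of [u v w], and no pair from each side has exactly two cross
    edges. If [x] sees [u] and [v] but not [w], a triangle vertex seeing [w] must see all three; so
    the cross edges form a perfect matching, which is excluded too. *)
Lemma triangle_cotriangle x y z u v w :
  e x y -> e x z -> e y z -> u != v -> u != w -> v != w ->
  ~~ e u v -> ~~ e u w -> ~~ e v w -> False.
Proof.
move=> exy exz eyz nuv nuw nvw euv euw evw.
have sh p q r : e p q -> e p r -> e q r -> [/\ p != u, p != v & p != w].
  move=> epq epr eqr; split; apply/eqP=> E; subst p.
  - by apply: (triangle_cotriangle_sharing u q r v w).
  - by apply: (triangle_cotriangle_sharing v q r u w); rewrite // 1?eq_sym // esym.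
  - by apply: (triangle_cotriangle_sharing w q r u v); rewrite // 1?eq_sym // esym.
have [nxu nxv nxw] := sh x y z exy exz eyz.
have [nyu nyv nyw] : [/\ y != u, y != v & y != w] by apply: (sh y x z); rewrite // esym.
have [nzu nzv nzw] : [/\ z != u, z != v & z != w].
  by apply: (sh z x y); rewrite // esym.
have [[nxy nxz] nyz] := (neq_e _ _ exy, neq_e _ _ exz, neq_e _ _ eyz).
have := Heb x y z u; have := Heb x y z v; have := Heb x y z w.
have := Heb x y u v; have := Heb x y u w; have := Heb x y v w.
have := Heb x z u v; have := Heb x z u w; have := Heb x z v w.
have := Heb y z u v; have := Heb y z u w; have := Heb y z v w.
have := Heb x u v w; have := Heb y u v w; have := Heb z u v w.
rewrite /= !inE !negb_or nuv nuw nvw nxu nxv nxw nyu nyv nyw nzu nzv nzw nxy nxz nyz.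
rewrite exy exz eyz (negPf euv) (negPf euw) (negPf evw).
move: (e x u) (e x v) (e x w) (e y u) (e y v) (e y w) (e z u) (e z v) (e z w).
by move=> [] [] [] [] [] [] [] [] [].
Qed.

Hypothesis triangle_free : forall x y z, e x y -> e x z -> ~~ e y z.

Lemma card_neighbours_le2 x : (#|[set y | e x y]| <= 2).
Proof.
rewrite leqNgt; apply/negP => /card_gt2P[y [z [t [[]]]]]; rewrite !inE.
move=> exy exz ext [nyz nzt nty].
have := Heb x y z t; rewrite /= !inE !negb_or (neq_e _ _ exy).
rewrite (neq_e _ _ exz) (neq_e _ _ ext) nyz nzt eq_sym nty exy exz ext.
by rewrite (negPf (triangle_free _ _ _ exy exz)) (negPf (triangle_free _ _ _ exy ext))
           (negPf (triangle_free _ _ _ exz ext)).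
Qed.

Let N x := [set y | e x y].

(** A component that is the 4-cycle [x a w b], recorded by its neighbourhoods. *)
Let quad x a b w :=
  [/\ N x = [set a; b], N a = [set x; w], N b = [set x; w] & N w = [set a; b]].

Hypothesis card_neighbours : forall x, #|[set y | e x y]| = 2.

Let exists_quad x : exists a b w, quad x a b w /\ uniq [:: x; a; b; w].
Proof.
have /eqP/cards2P[a [b [nab Nx]]] := card_neighbours x.
have Ne u v : (v \in N u) = e u v by rewrite inE.
have exa : e x a by rewrite -Ne /N Nx !inE eqxx.
have exb : e x b by rewrite -Ne /N Nx !inE eqxx orbT.
have [w ewa nwx] : exists2 w, e a w & w != x.
  have /eqP/cards2P[u [v [nuv Na]]] := card_neighbours a.
  have [eu|nu] := eqVneq u x.
    by exists v; rewrite -?Ne /N ?Na ?inE ?eqxx ?orbT // -eu eq_sym.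
  by exists u; rewrite -?Ne /N ?Na ?inE ?eqxx.
have eax : e a x by rewrite esym.
have nexw : ~~ e x w by apply: (triangle_free a).
have neab : ~~ e a b by apply: (triangle_free x).
have nwb : w != b by apply: contraNneq neab => <-.
(* Otherwise [b x a w] would be an induced path, with three edges. *)
have ebw : e b w.
  have := Heb x a b w; rewrite /= !inE !negb_or (neq_e _ _ exa) (neq_e _ _ exb).
  rewrite nab eq_sym nwx (neq_e _ _ ewa) eq_sym nwb exa exb ewa (negPf nexw) (negPf neab).
  by case: (e b w).
have u : uniq [:: x; a; b; w].
  rewrite /= !inE !negb_or (neq_e _ _ exa) (neq_e _ _ exb) eq_sym nwx nab.
  by rewrite (neq_e _ _ ewa) (neq_e _ _ ebw).
exists a, b, w; split=> //.
split=> //; apply: eq_set2_card2; rewrite ?card_neighbours ?Ne //.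
- by rewrite eq_sym.
- by rewrite eq_sym.
- by rewrite esym.
- by rewrite esym.
- by rewrite esym.
Qed.

(** Vertices reached by walks of length one or two. Going back reaches [x] itself, so this is the
    whole 4-cycle of [x]. *)
Let B x := N x :|: \bigcup_(y in N x) N y.

Let quad_B x a b w : quad x a b w -> B x = [set x; a; b; w].
Proof.
case=> Nx Na Nb _; rewrite /B Nx bigcup_setU !big_set1 Na Nb setUid.
by apply/setP => z; rewrite !inE; do 4!case: (z == _).
Qed.

Lemma dvdn_4_card_2regular : (4 %| #|T|).
Proof.
(* The fibre of [B] through [x] is therefore [B x] itself, so the fibres partition the vertices into
   blocks of size 4. *)
have BE x y : (B x == B y) = (y \in B x).
  have [a [b [w [q u]]]] := exists_quad x.
  have [Nx Na Nb Nw] := q.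
  apply/eqP/idP => [->|].
    by have [a' [b' [w' [/quad_B-> _]]]] := exists_quad y; rewrite !inE eqxx.
  rewrite (quad_B _ _ _ _ q) !inE -!orbA => /or4P[] /eqP ->.
  - by rewrite (quad_B x a b w).
  - rewrite (quad_B a x w b) //.
    by apply/setP => z; rewrite !inE; do 4!case: (z == _).
  - rewrite (quad_B b x w a) //; last by split; rewrite // setUC.
    by apply/setP => z; rewrite !inE; do 4!case: (z == _).
  - rewrite (quad_B w a b x) //; last by split; rewrite // setUC.
    by apply/setP => z; rewrite !inE; do 4!case: (z == _).
have cB x : #|B x| = 4.
  have [a [b [w [q u]]]] := exists_quad x.
  rewrite (quad_B _ _ _ _ q) -[4]/(size [:: x; a; b; w]) -(card_uniqP u).
  by apply: eq_card => z; rewrite !inE -!orbA.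
rewrite -cardsT.
rewrite (card_uniform_partition (n := 4) _ (preim_partitionP B [set: T])) ?dvdn_mull //.
move=> _ /imsetP[x _ ->]; rewrite -(cB x); apply: eq_card => y.
by rewrite inE in_setT BE.
Qed.
End ThreeEdgeFree.

End ThreeEdgeFreeGraphs.

(** * Weights as degree sums in the graph of positive edges *)

Lemma sum_edges_at n (f : {set 'I_n} -> int) (S : {set 'I_n}) x : x \in S ->
  \sum_(e in complete_edges S | x \in e) f e = \sum_(y in S :\ x) f [set x; y].
Proof.
move=> xS; rewrite -(big_imset (h := fun y => [set x; y]) f) /=.
  apply: eq_bigl => e; apply/andP/imsetP => [[]|[y]].
    rewrite !inE => /andP[eS /cards2P[a [b [nab E]]]]; rewrite E !inE.
    have [aS bS] : a \in S /\ b \in S by apply/andP; rewrite -!sub1set -subUset -E.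
    by case/orP=> /eqP ->; [exists b|exists a]; rewrite ?inE ?nab ?(eq_sym b) ?nab //;
      rewrite setUC.
  rewrite !inE => /andP[nyx yS] ->.
  by rewrite subUset !sub1set xS yS cards2 (eq_sym x) nyx !inE eqxx.
move=> y z; rewrite !inE => /andP[nyx _] /andP[nzx _] /setP/(_ y).
by rewrite !inE eqxx (negPf nyx) /= => /esym/eqP.
Qed.

Lemma weight_setU1 n (f : {set 'I_n} -> int) (S : {set 'I_n}) x : x \notin S ->
  weight f (x |: S) = \sum_(y in S) f [set x; y] + weight f S.
Proof.
move=> xS; rewrite /weight (bigID (fun e : {set 'I_n} => x \in e)) /=.
rewrite sum_edges_at ?setU11 // setU1K //; congr (_ + _); apply: eq_bigl => e.
rewrite !inE andbAC -subsetD1 setU1K // andbAC.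
Qed.

Lemma double_weight n (f : {set 'I_n} -> int) (S : {set 'I_n}) :
  2 * weight f S = \sum_(x in S) \sum_(y in S :\ x) f [set x; y].
Proof.
under eq_bigr => x xS do rewrite -sum_edges_at //.
rewrite (exchange_big_dep (mem (complete_edges S))) /=; last by move=> x e _ /andP[].
rewrite mulr_sumr; apply: eq_bigr => e; rewrite inE => eS.
have [/subsetP sub_eS /eqP ce] := andP eS.
rewrite (eq_bigl (mem e)) => [|x /=]; first by rewrite sumr_const ce mulr_natl.
by rewrite eS; apply/andb_idl => /sub_eS.
Qed.

Lemma weight_set4 n (f : {set 'I_n} -> int) x y z t : uniq [:: x; y; z; t] ->
  weight f [set x; y; z; t] =
    f [set x; y] + f [set x; z] + f [set x; t] +
    f [set y; z] + f [set y; t] + f [set z; t].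
Proof.
rewrite /= !inE !negb_or => /and3P[/and3P[nxy nxz nxt] /andP[nyz nyt] /andP[nzt _]].
have -> : [set x; y; z; t] = x |: (y |: (z |: (t |: set0))).
  by apply/setP => u; rewrite !inE orbF -!orbA.
rewrite !weight_setU1 ?inE ?negb_or ?nxy ?nxz ?nxt ?nyz ?nyt ?nzt //.
rewrite !big_setU1 ?inE ?negb_or ?nyz ?nyt ?nzt //= !big_set0 !addr0.
rewrite [weight f set0]big1 ?addr0 ?addrA //.
by move=> e; rewrite inE subset0 => /andP[/eqP->]; rewrite cards0.
Qed.

Section SignGraph.
Variables (n : nat) (f : {set 'I_n} -> int).
Hypothesis wf : weighting [:: -1; 1] f.

(** The condition [x != y] excludes [[set x; x]], a singleton on which [f] is unconstrained. *)
Definition positive_edge : rel 'I_n := fun x y => (x != y) && (f [set x; y] == 1).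
Local Notation e := positive_edge.

Lemma positive_edge_sym : symmetric e.
Proof. by move=> x y; rewrite /positive_edge eq_sym setUC. Qed.

Lemma positive_edge_irr : irreflexive e.
Proof. by move=> x; rewrite /positive_edge eqxx. Qed.

Lemma weight_positive_edge x y : x != y -> f [set x; y] = 2 * (e x y)%:Z - 1.
Proof.
move=> nxy; have := wf [set x; y]; rewrite !inE subsetT cards2 nxy => /(_ isT).
by rewrite /positive_edge nxy; case/orP => /eqP ->.
Qed.

Lemma three_edge_free_positive_edge :
  ~ zero_sum_copy 4 f -> three_edge_free _ e.
Proof.
move=> nz x y z t u; apply/eqP => s; apply: nz; exists [set x; y; z; t]; split.
  rewrite -[4%N]/(size [:: x; y; z; t]) -(card_uniqP u).
  by apply: eq_card => w; rewrite !inE -!orbA.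
rewrite weight_set4 //; move: u.
rewrite /= !inE !negb_or => /and3P[/and3P[nxy nxz nxt] /andP[nyz nyt] /andP[nzt _]].
by rewrite !weight_positive_edge //; lia.
Qed.

(** Handshake count: both sides sum [2 * e x y - 1] over ordered pairs of distinct vertices. *)
Lemma sum_positive_degrees :
  2 * weight f [set: 'I_n] =
  2 * (\sum_x #|[set y | e x y]|)%N%:Z - n%:Z * (n%:Z - 1).
Proof.
rewrite double_weight -natz natr_sum mulr_sumr.
have -> : n%:Z * (n%:Z - 1) = \sum_(x : 'I_n) (n%:Z - 1).
  by rewrite sumr_const card_ord -mulr_natl natz.
rewrite -sumrB; apply: eq_big => [x|x _]; first by rewrite inE.
have cD : #|[set: 'I_n] :\ x|%:Z = n%:Z - 1.
  by have := cardsD1 x [set: 'I_n]; rewrite inE cardsT card_ord; lia.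
rewrite -cD -[X in _ - X]natz -[X in _ - X%:R]sum1_card natr_sum.
have -> : #|[set y | e x y]|%:R = \sum_(y in [set: 'I_n] :\ x) (e x y)%:Z.
  rewrite -sum1_card natr_sum big_mkcond [RHS]big_mkcond /=.
  apply: eq_bigr => y _; rewrite !inE /positive_edge eq_sym andbT.
  by case: (y != x); case: (_ == 1).
rewrite mulr_sumr -sumrB; apply: eq_bigr => y; rewrite !inE andbT => nyx.
by rewrite weight_positive_edge // eq_sym.
Qed.

End SignGraph.

(** * Forcing a zero-sum copy of [K_4] *)

Lemma positive_triangle_free_bound n (f : {set 'I_n} -> int) :
  weighting [:: -1; 1] f -> ~ zero_sum_copy 4 f ->
  (forall x y z, positive_edge n f x y -> positive_edge n f x z ->
     ~~ positive_edge n f y z) ->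
  weight f [set: 'I_n] < (g n)%:Z - 'C(n, 2)%:Z.
Proof.
move=> wf nz tf; have He := three_edge_free_positive_edge _ _ wf nz.
have degs x := card_neighbours_le2 _ _ (positive_edge_irr n f) He tf x.
have sum_le : (\sum_x #|[set y | positive_edge n f x y]| <= \sum_(x < n) 2)%N.
  by apply: leq_sum => x _.
have := sum_positive_degrees _ _ wf; have := double_bin2 n.
move: sum_le; rewrite sum_nat_const card_ord; set D := (\sum_x _)%N => le_D bn W.
rewrite ltNge; apply/negP => le_gW.
(* The weight is [D - 'C(n, 2)] with [D <= 2 * n]. If 4 divides [n], then [g n] exceeds [2 * n];
   otherwise [D = 2 * n], so all degrees are 2 and 4 divides [n] after all. *)
have g_le : (g n <= D)%N by lia.
have eD : D = (\sum_(x < n) 2)%N.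
  by rewrite sum_nat_const card_ord; move: g_le; rewrite /g; case: ifP => _; lia.
have deg2 x : #|[set y | positive_edge n f x y]| = 2%N.
  have [_ /esym] := leqif_sum (fun i (_ : true) => leqif_eq (degs i)).
  by rewrite -/D eD eqxx => /forallP/(_ x)/eqP.
have := dvdn_4_card_2regular _ _ (positive_edge_sym n f) (positive_edge_irr n f)
  He tf deg2.
rewrite card_ord /dvdn => n4; move: g_le eD; rewrite /g n4 sum_nat_const card_ord; lia.
Qed.

Lemma weightN n (f : {set 'I_n} -> int) S : weight (fun e => - f e) S = - weight f S.
Proof. exact: sumrN. Qed.

Lemma zero_sum_copy4 n (f : {set 'I_n} -> int) :
  weighting [:: -1; 1] f ->
  `|weight f [set: 'I_n]| <= 'C(n, 2)%:Z - (g n)%:Z -> zero_sum_copy 4 f.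
Proof.
move=> wf le_W.
have [/existsP[S /andP[/eqP cS /eqP wS]]|nz] :=
  boolP [exists S : {set 'I_n}, (#|S| == 4%N) && (weight f S == 0)]; first by exists S.
have {}nz : ~ zero_sum_copy 4 f.
  by case=> S [/eqP cS /eqP wS]; case/existsP: nz; exists S; rewrite cS wS.
have [/existsP[x /existsP[y /existsP[z /and3P[exy exz eyz]]]]|tf] := boolP
  [exists x, exists y, exists z,
    [&& positive_edge n f x y, positive_edge n f x z & positive_edge n f y z]]; last first.
  suff : weight f [set: 'I_n] < (g n)%:Z - 'C(n, 2)%:Z by lia.
  apply: positive_triangle_free_bound => // x y z exy exz; apply: contra tf => eyz.
  apply/existsP; exists x; apply/existsP; exists y; apply/existsP; exists z.
  by rewrite exy exz.
(* A positive triangle rules out a negative one, so the bound applies to [- f]. *)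
suff : weight (fun e => - f e) [set: 'I_n] < (g n)%:Z - 'C(n, 2)%:Z.
  by rewrite weightN; lia.
apply: positive_triangle_free_bound.
- by move=> e /wf; rewrite !inE => /orP[] /eqP ->.
- by case=> S [cS /eqP]; rewrite weightN oppr_eq0 => /eqP wS; apply: nz; exists S.
have neg u v : positive_edge n (fun e => - f e) u v -> u != v /\ ~~ positive_edge n f u v.
  by move=> /andP[nuv]; rewrite /positive_edge nuv eqr_oppLR => /eqP->.
move=> u v w /neg[nuv euv] /neg[nuw euw]; apply/negP => /neg[nvw evw].
exact: (triangle_cotriangle _ _ (positive_edge_sym n f) (positive_edge_irr n f)
  (three_edge_free_positive_edge _ _ wf nz) x y z u v w).
Qed.

Theorem theorem3 :
  [/\ forall m : nat, (2 <= m)%N -> m <> 4%N ->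
        infinitely_many (fun n : nat =>
          exists f : {set 'I_n} -> int,
            [/\ weighting [:: -1; 1] f,
                weight f [set: 'I_n] = 0
              & ~ zero_sum_copy m f]),
      forall n : nat, (5 <= n)%N ->
        forall f : {set 'I_n} -> int,
          weighting [:: -1; 1] f ->
          `|weight f [set: 'I_n]| <= 'C(n, 2)%:Z - (g n)%:Z ->
          zero_sum_copy 4 f
    & infinitely_many (fun n : nat =>
        exists f : {set 'I_n} -> int,
          [/\ weighting [:: -2; -1; 0; 1; 2] f,
              weight f [set: 'I_n] = 0
            & ~ zero_sum_copy 4 f])].
Proof.
split; last exact: no_zero_sum_copy4.
  move=> m m_ge2 m_neq4.
  (* A square root of [m] is at most [m], so being a square is a finite search. *)
  have [/existsP[q /eqP m_sq]|nsq] := boolP [exists q : 'I_m.+1, m == (q ^ 2)%N].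
    rewrite m_sq; apply: no_zero_sum_copy_square.
    by case: (val q) m_sq m_ge2 m_neq4 => [|[|[|k]]] // ->.
  apply: no_zero_sum_copy_nonsquare => q m_sq; case/existsP: nsq.
  have lt_qm : (q < m.+1)%N by rewrite m_sq; nia.
  by exists (Ordinal lt_qm); apply/eqP.
by move=> n _ f; apply: zero_sum_copy4.
Qed.
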